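(* In any compact flat Riemannian manifold $\mathcal{M}$, the class of parallel distributions with compact leaves is closed under spans and intersections.
   Context: Compact flat Riemannian manifolds are understood to be connected, that is, of the form $\mathcal{E}/\Pi$ for a Bieberbach group $\Pi$ (a torsion-free discrete group of isometries with a compact fundamental domain) in a Euclidean affine space $\mathcal{E}$. A distribution on $\mathcal{M}$ is a smooth vector subbundle of $T\mathcal{M}$; it is parallel if it is invariant under parallel transport of the Levi-Civita connection. The leaves of an integrable distribution are its maximal connected integral manifolds; compactness of a leaf refers to its own manifold topology. The span (intersection) of a family of parallel distributions is the distribution whose fibre at each point is the span (intersection) of the fibres of the members of the family. *)

(* Defs.v *)
From mathcomp Require Import all_boot all_order all_algebra.
From mathcomp Require Import all_classical all_reals all_analysis.

Set Implicit Arguments.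
Unset Strict Implicit.
Unset Printing Implicit Defensive.

Import Order.TTheory GRing.Theory Num.Theory.
Import numFieldNormedType.Exports.

Local Open Scope classical_set_scope.
Local Open Scope ring_scope.

(* The Euclidean affine space of dimension n is 'rV[R]_n. The library's norm
   on 'rV[R]_n is the sup norm: it has the right topology but the wrong
   isometries. *)
Definition eucl_dist (R : realType) (n : nat) (x y : 'rV[R]_n) : R :=
  Num.sqrt (\sum_(i < n) (x ord0 i - y ord0 i) ^+ 2).

Definition eucl_isometry (R : realType) (n : nat) (g : 'rV[R]_n -> 'rV[R]_n) :=
  forall x y, eucl_dist (g x) (g y) = eucl_dist x y.

Definition isometry_group (R : realType) (n : nat)
    (Pi : set ('rV[R]_n -> 'rV[R]_n)) : Prop :=
  [/\ forall g, Pi g -> eucl_isometry g,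
      Pi id,
      forall g h, Pi g -> Pi h -> Pi (g \o h) &
      forall g, Pi g -> exists h, [/\ Pi h, cancel g h & cancel h g]].

(* The isometry group carries the compact-open topology. *)
Definition discrete_maps (R : realType) (n : nat)
    (Pi : set ('rV[R]_n -> 'rV[R]_n)) : Prop :=
  let P : set {compact-open, 'rV[R]_n -> 'rV[R]_n} := Pi in P `<=` isolated P.

Definition torsion_free (T : Type) (Pi : set (T -> T)) : Prop :=
  forall g m, Pi g -> (0 < m)%N -> iter m g =1 id -> g =1 id.

Definition fundamental_domain (R : realType) (n : nat)
    (Pi : set ('rV[R]_n -> 'rV[R]_n)) (K : set 'rV[R]_n) : Prop :=
  (\bigcup_(g in Pi) (g @` K) = setT) /\
  (forall g, Pi g -> g <> id ->
     interior K `&` (g @` interior K) = set0).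

Definition bieberbach (R : realType) (n : nat)
    (Pi : set ('rV[R]_n -> 'rV[R]_n)) : Prop :=
  [/\ isometry_group Pi, discrete_maps Pi, torsion_free Pi &
      exists2 K, compact K & fundamental_domain Pi K].

(* The compact flat manifold M = E/Pi, as a set, is the range of [pi_orbit Pi];
   its smooth and Riemannian structures are those making the covering
   projection [pi_orbit Pi : E -> E/Pi] a local isometry. *)
Definition pi_orbit (T : Type) (Pi : set (T -> T)) (x : T) : set T :=
  [set g x | g in Pi].

Fixpoint Ck (R : realType) (V W : normedModType R) (k : nat) (U : set V)
    (f : V -> W) : Prop :=
  if k is k'.+1 then
    (forall x, U x -> differentiable f x) /\
    (forall v : V, Ck k' U ('D_v f))
  else forall x, U x -> {for x, continuous f}.

(* U is meant to be open. *)
Definition smooth (R : realType) (V W : normedModType R) (U : set V)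
    (f : V -> W) : Prop := forall k, Ck k U f.

(* A distribution on M. The tangent bundle of M is the quotient of
   TE = E x 'rV[R]_n by the differentials (x, v) |-> (g x, 'd g x v) of the
   g in Pi, so a family of subspaces of the fibres of TM is the same thing as
   a Pi-invariant family D x of subspaces of 'rV[R]_n = T_x E, where D x
   corresponds to the fibre over [pi_orbit Pi x]. *)
Definition Pi_invariant (R : realType) (n : nat)
    (Pi : set ('rV[R]_n -> 'rV[R]_n)) (D : 'rV[R]_n -> set 'rV[R]_n) : Prop :=
  forall g, Pi g -> forall x, D (g x) = 'd g x @` D x.

Definition smooth_subbundle (R : realType) (n : nat)
    (D : 'rV[R]_n -> set 'rV[R]_n) : Prop :=
  exists k : nat, forall x, exists (U : set 'rV[R]_n)
      (e : 'I_k -> 'rV[R]_n -> 'rV[R]_n),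
    [/\ open U, U x, forall i, smooth U (e i) &
        forall y, U y -> let X := [tuple e i y | i < k] in
          free X /\ D y = [set v | v \in <<X>>%VS]].

Definition flat_distribution (R : realType) (n : nat)
    (Pi : set ('rV[R]_n -> 'rV[R]_n)) (D : 'rV[R]_n -> set 'rV[R]_n) : Prop :=
  Pi_invariant Pi D /\ smooth_subbundle D.

(* Curves in M are the projections of curves c in E, and t |-> (c t, X t)
   represents a vector field along such a curve. The Christoffel symbols of
   the Levi-Civita connection vanish in the affine coordinates of E, so the
   covariant derivative of X along c is X' whatever c is. *)
Definition parallel_along (R : realType) (n : nat) (c X : R^o -> 'rV[R]_n) :
    Prop :=
  forall t : R^o, 0 <= t <= 1 -> is_derive t 1 X 0.

Definition parallel (R : realType) (n : nat)
    (D : 'rV[R]_n -> set 'rV[R]_n) : Prop :=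
  forall c X : R^o -> 'rV[R]_n, smooth setT c -> parallel_along c X ->
    D (c 0) (X 0) <-> D (c 1) (X 1).

(* (N, j) is an injectively immersed k-dimensional submanifold of M, tangent
   to D: each point of N lies in the image of a local parametrization psi on
   which j is the projection of an immersion phi into E (an immersion into M
   lifts locally to E) whose differential at u has range D (phi u). The
   smooth structure of N is determined by its topology and j. *)
Definition integral_manifold (R : realType) (n : nat)
    (Pi : set ('rV[R]_n -> 'rV[R]_n)) (D : 'rV[R]_n -> set 'rV[R]_n)
    (N : topologicalType) (j : N -> set 'rV[R]_n) : Prop :=
  [/\ hausdorff_space N, @second_countable N, injective j &
    exists k : nat, forall p : N,
    exists (U : set 'rV[R]_k) (phi : 'rV[R]_k -> 'rV[R]_n) (psi : 'rV[R]_k -> N),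
    [/\ open U,
        (exists2 u, U u & psi u = p),
        [/\ {in U &, injective psi},
            (forall u, U u -> {for u, continuous psi}) &
            (forall A, open A -> A `<=` U -> open (psi @` A))],
        (forall u, U u -> j (psi u) = pi_orbit Pi (phi u)) &
        [/\ smooth U phi,
            (forall u, U u -> injective ('d phi u)) &
            (forall u, U u -> range ('d phi u) = D (phi u))]]].

Definition connected_integral_manifold (R : realType) (n : nat)
    (Pi : set ('rV[R]_n -> 'rV[R]_n)) (D : 'rV[R]_n -> set 'rV[R]_n)
    (N : topologicalType) (j : N -> set 'rV[R]_n) : Prop :=
  [/\ integral_manifold Pi D j, connected [set: N] & [set: N] !=set0].

Definition leaf (R : realType) (n : nat)
    (Pi : set ('rV[R]_n -> 'rV[R]_n)) (D : 'rV[R]_n -> set 'rV[R]_n)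
    (N : topologicalType) (j : N -> set 'rV[R]_n) : Prop :=
  connected_integral_manifold Pi D j /\
  forall (N' : topologicalType) (j' : N' -> set 'rV[R]_n),
    connected_integral_manifold Pi D j' ->
    range j `<=` range j' -> range j' = range j.

Definition compact_leaves (R : realType) (n : nat)
    (Pi : set ('rV[R]_n -> 'rV[R]_n)) (D : 'rV[R]_n -> set 'rV[R]_n) : Prop :=
  forall (N : topologicalType) (j : N -> set 'rV[R]_n),
    leaf Pi D j -> compact [set: N].

Definition parallel_distribution_with_compact_leaves (R : realType) (n : nat)
    (Pi : set ('rV[R]_n -> 'rV[R]_n)) (D : 'rV[R]_n -> set 'rV[R]_n) : Prop :=
  [/\ flat_distribution Pi D, parallel D & compact_leaves Pi D].

Definition span_distribution (R : realType) (n : nat) (I : Type)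
    (D : I -> 'rV[R]_n -> set 'rV[R]_n) : 'rV[R]_n -> set 'rV[R]_n :=
  fun x => [set v | exists2 X : seq 'rV[R]_n,
    (forall w, w \in X -> exists i, D i x w) & v \in <<X>>%VS].

Definition cap_distribution (R : realType) (n : nat) (I : Type)
    (D : I -> 'rV[R]_n -> set 'rV[R]_n) : 'rV[R]_n -> set 'rV[R]_n :=
  fun x => \bigcap_i D i x.

(* Main.v *)
Require Import Defs.
From mathcomp Require Import all_boot all_order all_algebra.
From mathcomp Require Import all_classical all_reals all_analysis.
From HB Require Import structures.
From mathcomp Require Import ring lra.

Set Implicit Arguments.
Unset Strict Implicit.
Unset Printing Implicit Defensive.

Import Order.TTheory GRing.Theory Num.Theory.
Import numFieldNormedType.Exports.

Local Open Scope classical_set_scope.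
Local Open Scope ring_scope.

(** A parallel distribution on E/Pi is a constant subspace V of the space of
    translations, preserved by the linear parts of Pi, and its leaves are the
    images of the affine subspaces x + V. Such a leaf is compact exactly when
    the elements of Pi that preserve x + V act cocompactly on it: every point
    of x + V is moved by Pi to a point of x + V at bounded distance from x.
    Call V a compact direction ([compact_dir]) if this holds for all x. The
    theorem then becomes a statement about subspaces, and bounded displacement
    arguments suffice for it: the lattice of translations of Pi is never
    introduced.

    For sums ([compact_dirD]): a point x + v + w with v in V and w in W is first
    moved by an element that brings x + v back near x within x + V; the linear
    part of that element preserves W, so the image is x + e + w' with e in V
    bounded and w' in W. An element that brings x + w' back near x within x + W
    now brings x + e + w' near x, and within x + V + W since it preserves V.

    For intersections ([compact_dirI]): as Pi is discrete and V is a compact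
    direction, only finitely many of the subspaces gx + V with g in Pi meet a
    given ball ([translates_near]). By compactness of E/Pi a point of
    x + (V cap W) is moved by some g in Pi into a fixed ball about x; then gx + V
    and gx + W, hence gx + (V cap W), range over finitely many subspaces, and
    each of them is moved back to x + (V cap W) by one fixed element of Pi.

    Arbitrary families reduce to pairs by dimension: a sum of members of the
    family of largest dimension contains every member, and dually for
    intersections.

    The rest is the dictionary between leaves and affine subspaces. The image of
    x + V, with the quotient topology of its parameter space, is a connected
    integral manifold ([leaf_integral]); this is where the discreteness and
    freeness of the action enter. A connected integral manifold that meets the
    image of x + V lies in it, because a map whose differential takes values in
    V moves within a translate of V ([flat_displacement]) and membership is then
    a clopen condition ([integral_in_leaf]). So the leaves are these images as
    sets. For the topology of an arbitrary leaf, the inverse function theorem,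
    in the form of [immersion_onto], shows that the parametrization by x + V is
    continuous; the leaf is then the image of a closed ball as soon as V is a
    compact direction ([cocompact_compact_leaves]). *)

(** Additive identities between row vectors, entry by entry. *)
Ltac row_ring := apply/rowP => ?; rewrite !mxE; ring.

(** * Isometries of Euclidean space and the sup norm *)

Lemma linear_is_mulmx (R : realType) (m n : nat) (h : 'rV[R]_m -> 'rV[R]_n) :
  (forall a x y, h (a *: x + y) = a *: h x + h y) ->
  exists L : 'M[R]_(m, n), forall x, h x = x *m L.
Proof.
move=> hl.
pose hL := HB.pack_for {linear 'rV[R]_m -> 'rV[R]_n} h
  (GRing.isLinear.Build _ _ _ _ h hl).
by exists (lin1_mx hL) => x; rewrite mul_rV_lin1.
Qed.

(** The sup norm gives the topology, but isometries are understood through this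
    inner product. *)
Definition dot (R : realType) (n : nat) (x y : 'rV[R]_n) : R :=
  (x *m y^T) ord0 ord0.

Section Dot.
Variables (R : realType) (n : nat).
Implicit Types x y z : 'rV[R]_n.

Lemma dotC x y : dot x y = dot y x.
Proof. by rewrite /dot !mxE; apply: eq_bigr => i _; rewrite !mxE mulrC. Qed.

Lemma dot_linearl a x y z : dot (a *: x + y) z = a * dot x z + dot y z.
Proof. by rewrite /dot mulmxDl -scalemxAl !mxE. Qed.

Lemma dot_linearr a x y z : dot z (a *: x + y) = a * dot z x + dot z y.
Proof. by rewrite dotC dot_linearl !(dotC z). Qed.

Lemma dot_subsub x y : dot (x - y) (x - y) = dot x x - 2 * dot x y + dot y y.
Proof.
have -> : x - y = -1 *: y + x by rewrite scaleN1r addrC.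
by rewrite dot_linearl !dot_linearr (dotC y x); lra.
Qed.

Lemma dotxx x : dot x x = \sum_(i < n) x ord0 i ^+ 2.
Proof. by rewrite /dot mxE; apply: eq_bigr => i _; rewrite mxE expr2. Qed.

Lemma dotxx_ge0 x : 0 <= dot x x.
Proof. by rewrite dotxx sumr_ge0// => i _; rewrite sqr_ge0. Qed.

Lemma dotxx_eq0 x : dot x x = 0 -> x = 0.
Proof.
rewrite dotxx => /eqP; rewrite psumr_eq0; last by move=> i _; rewrite sqr_ge0.
move=> /allP x0; apply/rowP => i; rewrite mxE; apply/eqP.
by have := x0 i (mem_index_enum i); rewrite sqrf_eq0.
Qed.

Lemma eucl_distE x y : eucl_dist x y = Num.sqrt (dot (x - y) (x - y)).
Proof. by rewrite dotxx; congr Num.sqrt; apply: eq_bigr => i _; rewrite !mxE. Qed.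

End Dot.

Section Norm.
Variables (R : realType).

Lemma norm_coord m n (x : 'M[R]_(m, n)) i j : `|x i j| <= `|x|.
Proof.
rewrite /Num.Def.normr /= mx_normrE.
exact: (le_bigmax _ (fun ij : 'I_m * 'I_n => `|x ij.1 ij.2|) (i, j)).
Qed.

Lemma norm_row_le n (x : 'rV[R]_n) (r : R) :
  0 <= r -> (forall i, `|x ord0 i| <= r) -> `|x| <= r.
Proof.
move=> r0 xr; rewrite /Num.Def.normr /= mx_normrE.
by apply: bigmax_le => // -[i j] _ /=; rewrite (ord1 i).
Qed.

Lemma norm_row_lt n (x : 'rV[R]_n) (r : R) :
  0 < r -> (forall i, `|x ord0 i| < r) -> `|x| < r.
Proof.
move=> r0 xr; rewrite /Num.Def.normr /= mx_normrE.
by apply: bigmax_lt => // -[i j] _ /=; rewrite (ord1 i).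
Qed.

Lemma mulmx_bound m n (A : 'M[R]_(m, n)) :
  exists2 C : R, 0 < C & forall x : 'rV[R]_m, `|x *m A| <= C * `|x|.
Proof.
exists (1 + \sum_i \sum_j `|A i j|).
  by apply: ltr_pwDl => //; apply: sumr_ge0 => i _; apply: sumr_ge0.
move=> x; apply: norm_row_le => [|j].
  apply: mulr_ge0 => //; apply: addr_ge0 => //.
  by apply: sumr_ge0 => i _; apply: sumr_ge0.
rewrite mxE (le_trans (ler_norm_sum _ _ _))// mulrDl mul1r.
rewrite -[leLHS]add0r lerD// mulr_suml ler_sum// => i _.
rewrite normrM mulrC ler_pM//; first by rewrite (bigD1 j)//= lerDl sumr_ge0.
exact: norm_coord.
Qed.

End Norm.

Section Isometry.
Variables (R : realType) (n : nat).

Lemma isometry_dot (g : 'rV[R]_n -> 'rV[R]_n) x y : eucl_isometry g ->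
  dot (g x - g y) (g x - g y) = dot (x - y) (x - y).
Proof.
move=> /(_ x y); rewrite !eucl_distE => /(congr1 (fun r => r ^+ 2)).
by rewrite !sqr_sqrtr// dotxx_ge0.
Qed.

(** After subtracting g 0 the map preserves norms and distances, hence inner
    products by polarization, so that the squared length of
    h (a x + y) - a h x - h y expands to 0. *)
Lemma isometry_affine (g : 'rV[R]_n -> 'rV[R]_n) : eucl_isometry g ->
  exists L : 'M[R]_n, forall x y, g y - g x = (y - x) *m L.
Proof.
move=> gi; pose h x := g x - g 0.
have hB x y : h x - h y = g x - g y by rewrite /h opprB addrA subrK.
have hn x : dot (h x) (h x) = dot x x.
  by have := isometry_dot x 0 gi; rewrite subr0.
clearbody h.
have hd x y : dot (h x) (h y) = dot x y.
  have := isometry_dot x y gi; rewrite -hB !dot_subsub !hn; lra.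
have [L hL] : exists L : 'M[R]_n, forall x, h x = x *m L.
  apply: linear_is_mulmx => a x y; apply/eqP; rewrite -subr_eq0; apply/eqP.
  apply: dotxx_eq0; rewrite dot_subsub dot_linearl !dot_linearr !hd.
  rewrite !dot_linearl !dot_linearr.
  rewrite (dotC y x); lra.
by exists L => x y; rewrite mulmxBl -!hL hB.
Qed.

(** The constant is crude on purpose: only its independence of g matters, as it
    lets every later estimate be made in the sup norm. *)
Lemma isometry_lip (g : 'rV[R]_n -> 'rV[R]_n) x y : eucl_isometry g ->
  `|g x - g y| <= Num.sqrt n.+1%:R * `|x - y|.
Proof.
move=> gi; have d := isometry_dot x y gi.
apply: norm_row_le => [|i]; first by rewrite mulr_ge0// sqrtr_ge0.
rewrite -(@ler_pXn2r _ 2)// ?nnegrE ?mulr_ge0 ?sqrtr_ge0//.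
rewrite exprMn sqr_sqrtr// real_normK ?num_real//.
have : (g x - g y) ord0 i ^+ 2 <= dot (g x - g y) (g x - g y).
  by rewrite dotxx (bigD1 i)//= lerDl sumr_ge0// => j _; rewrite sqr_ge0.
move/le_trans; apply; rewrite d dotxx.
apply: (@le_trans _ _ (\sum_(j < n) `|x - y| ^+ 2)).
  apply: ler_sum => j _; rewrite -[leLHS]real_normK ?num_real//.
  by rewrite ler_pXn2r// ?nnegrE// norm_coord.
rewrite sumr_const card_ord -[leLHS]mulr_natl ler_wpM2r ?sqr_ge0//.
by rewrite ler_nat.
Qed.

End Isometry.

(** * Discreteness of the group *)

Section Finite.

(** Pigeonhole: rounding the coordinates to a grid of step d is injective on S
    and takes finitely many values. *)
Lemma separated_finite (R : realType) (T : Type) (I : finType) (S : set T)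
    (F : T -> I -> R) (M d : R) : 0 < d ->
  (forall g i, S g -> `|F g i| <= M) ->
  (forall g h, S g -> S h -> (forall i, `|F g i - F h i| < d) -> g = h) ->
  finite_set S.
Proof.
move=> d0 FM Fd.
pose N := Num.truncn (2 * M / d).
pose tr g i := Num.truncn ((F g i + M) / d).
pose code g : {ffun I -> 'I_N.+1} := [ffun i => inord (tr g i)].
have pos g i : S g -> 0 <= (F g i + M) / d.
  move=> /(FM g i); rewrite ler_norml => /andP[? ?].
  by apply: divr_ge0; [lra|exact: ltW].
have bd g i : S g -> (tr g i < N.+1)%N.
  move=> Sg; rewrite ltnS le_truncn// ler_pM2r ?invr_gt0//.
  by have := FM _ i Sg; rewrite ler_norml => /andP[? ?]; lra.
pose code' (g : {g | S g}) := code (sval g).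
suff finj : injective code'.
  have -> : S = sval @` (code' @^-1` setT).
    by apply/seteqP; split=> [g Sg|_ [[g Sg] _ <-]]; first by exists (exist _ g Sg).
  by apply/finite_image/finite_preimage/finite_finset => g h _ _; exact: finj.
move=> [g Sg] [h Sh] /= gh; apply: eq_exist => /=.
apply: Fd => // i; have /(congr1 val) := congr1 (fun f : {ffun I -> 'I_N.+1} => f i) gh.
rewrite !ffunE /= !inordK ?bd// => tgh.
have /andP[g1 g2] := truncn_itv (pos g i Sg).
have /andP[h1 h2] := truncn_itv (pos h i Sh).
rewrite -/(tr _ _) tgh in g1 g2; rewrite -/(tr _ _) in h1 h2.
have E : F g i - F h i = ((F g i + M) / d - (F h i + M) / d) * d.
  by field; rewrite gt_eqF.
rewrite E normrM (gtr0_norm d0) -[ltRHS]mul1r ltr_pM2r//.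
move: g2 h2; rewrite -!natr1 => g2 h2.
by rewrite ltr_norml; apply/andP; split; lra.
Qed.

Lemma finite_set_bound (R : realType) (T : Type) (S : set T) (f : T -> R) :
  finite_set S -> exists2 M, 0 <= M & forall t, S t -> f t <= M.
Proof.
move=> Sf; have /finite_seqP[s sE] : finite_set (f @` S) by exact: finite_image.
exists (\big[Num.max/0]_(r <- s) r) => [|t St]; first exact: bigmax_ge_id.
apply: (le_bigmax_seq 0 (f t) predT id) => //.
have : (f @` S) (f t) by exists t.
by rewrite sE.
Qed.

Lemma finite_set_gap (R : realType) (T : Type) (S : set T) (f : T -> R) :
  finite_set S -> (forall t, S t -> 0 < f t) ->
  exists2 e, 0 < e & forall t, S t -> e <= f t.
Proof.
move=> Sf f0; have [M M0 hM] := finite_set_bound (fun t => (f t)^-1) Sf.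
exists (M + 1)^-1 => [|t St]; first by rewrite invr_gt0 ltr_pwDr.
rewrite -[leRHS]invrK lef_pV2 ?posrE ?invr_gt0 ?f0// ?ltr_pwDr//.
by rewrite (le_trans (hM _ St))// lerDl.
Qed.

End Finite.

Section Group.
Variables (R : realType) (n : nat) (Pi : set ('rV[R]_n -> 'rV[R]_n)).
Hypotheses (hG : isometry_group Pi) (hd : discrete_maps Pi).

Let C : R := Num.sqrt n.+1%:R.

Lemma group_isometry g : Pi g -> eucl_isometry g. Proof. by case: hG => + _ _ _; apply. Qed.
Lemma group_id : Pi id. Proof. by case: hG. Qed.
Lemma group_comp g h : Pi g -> Pi h -> Pi (g \o h). Proof. by case: hG => _ _ + _; apply. Qed.
Lemma group_inv g : Pi g -> exists h, [/\ Pi h, cancel g h & cancel h g].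
Proof. by case: hG => _ _ _; apply. Qed.
Lemma group_lip g x y : Pi g -> `|g x - g y| <= C * `|x - y|.
Proof. by move=> /group_isometry; exact: isometry_lip. Qed.
Lemma group_affine g : Pi g ->
  exists L : 'M[R]_n, forall x y, g y - g x = (y - x) *m L.
Proof. by move=> /group_isometry; exact: isometry_affine. Qed.

(** An isometry close to the identity on the unit ball is close to it on every
    ball, with an error growing linearly in the radius. So the isometries that
    move the unit ball by little generate a filter converging to the identity in the
    compact-open topology, where the identity is isolated in Pi. *)
Lemma discrete_gap : exists2 d : R, 0 < d &
  forall g, Pi g -> (forall x, `|x| <= 1 -> `|g x - x| < d) -> g = id.
Proof.
pose near d := [set g : 'rV[R]_n -> 'rV[R]_n |
  forall r x, 0 <= r -> `|x| <= r -> `|g x - x| <= (1 + 2 * r) * d].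
pose F : set_system {compact-open, 'rV[R]_n -> 'rV[R]_n} :=
  filter_from [set d : R | 0 < d] near.
have FF : Filter F.
  apply: filter_from_filter; first by exists 1 => /=.
  move=> d1 d2 /= d10 d20; exists (Num.min d1 d2) => /=; first by rewrite lt_min d10.
  move=> g gn; split=> r x r0 xr; rewrite (le_trans (gn _ _ r0 xr))//;
    by rewrite ler_wpM2l ?addr_ge0 ?mulr_ge0// ge_min lexx ?orbT.
have Fid : F --> (id : {compact-open, 'rV[R]_n -> 'rV[R]_n}).
  apply/compact_open_fam_compactP; first by move=> x.
  apply/fam_cvgP => K cK V /uniform_nbhs[E [+ EV]].
  rewrite -entourage_ballE => -[e /= e0 eE].
  have [M [_ MK]] := compact_bounded cK.
  pose r := Num.max (M + 1) 0.
  have r0 : 0 <= r by rewrite le_max lexx orbT.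
  have p0 : 0 < 1 + 2 * r + 1 by lra.
  exists (e / (1 + 2 * r + 1)) => [/=|g gn]; first by rewrite divr_gt0.
  apply: EV => x Kx; apply: eE; rewrite /= -ball_normE /= distrC.
  have xr : `|x| <= r by rewrite le_max MK// ltrDl.
  rewrite (le_lt_trans (gn _ _ r0 xr))// mulrCA -[ltRHS]mulr1 ltr_pM2l//.
  by rewrite ltr_pdivrMr// mul1r ltrDl.
have [_ [V Vid VP]] := hd group_id.
have [d /= d0 dV] := Fid V Vid.
exists d => // g Pg gd; suff /[!VP] : (V `&` Pi) g by [].
split=> //; apply: dV => r x r0 xr.
have [L gL] := group_affine Pg.
have gE y : g y = g 0 + y *m L by rewrite -{2}[y]subr0 -gL addrC subrK.
have g0d : `|g 0| <= d by rewrite -[g 0]subr0 ltW// gd// normr0.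
have [r1|r1] := leP r 1.
  rewrite (le_trans (ltW (gd x _)))//; first exact: le_trans r1.
  by rewrite ler_peMl ?(ltW d0)//; lra.
have rp : 0 < r by lra.
(* Outside the unit ball, rescale x into it; g is affine. *)
have -> : g x - x = r *: (g (r^-1 *: x) - r^-1 *: x) + (1 - r) *: g 0.
  rewrite (gE x) (gE (r^-1 *: x)) -scalemxAl scalerBr scalerDr !scalerA.
  rewrite mulfV ?gt_eqF// !scale1r scalerBl scale1r.
  by rewrite [RHS]addrC -!addrA; congr (_ + _); rewrite addKr.
rewrite (le_trans (ler_normD _ _))// !normrZ (gtr0_norm rp).
have : `|g (r^-1 *: x) - r^-1 *: x| < d.
  by apply: gd; rewrite normrZ gtr0_norm ?invr_gt0// ler_pdivrMl// mulr1.
rewrite (ltr0_norm (_ : 1 - r < 0)); last lra.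
move: g0d; set a := `|g 0|; set b := `|_ - _| => ad bd.
have ? : r * b <= r * d by rewrite ler_pM2l// ltW.
have ? : (r - 1) * a <= (r - 1) * d by rewrite ler_pM2l// subr_gt0.
by rewrite opprB; lra.
Qed.

(** Proper discontinuity. An isometry is determined by its values at 0 and at
    the basis vectors; those values are bounded on the set, and if they are
    close for g and h then h^-1 g is close to the identity on the unit ball,
    hence equal to it by [discrete_gap]. *)
Lemma bounded_displacement_finite x (r : R) :
  finite_set [set g | Pi g /\ `|g x - x| <= r].
Proof.
have [d d0 dP] := discrete_gap.
have C0 : 0 < C by rewrite sqrtr_gt0 ltr0n.
(* Values within e at 0 and at the n basis vectors give values within
   (2 n + 1) e on the unit ball, and h^-1 costs a further factor C. *)
pose e : R := d / (C * n.*2.+1%:R).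
have e0 : 0 < e by rewrite divr_gt0// mulr_gt0.
(* The n + 1 points 0, e_1, ..., e_n. *)
pose p (i : 'I_n.+1) : 'rV[R]_n := if unlift ord0 i is Some j then delta_mx 0 j else 0.
have p1 i : `|p i| <= 1.
  rewrite /p; case: unlift => [j|]; last by rewrite normr0.
  by apply: norm_row_le => // k; rewrite mxE; case: (_ && _); rewrite ?normr1 ?normr0.
pose F (g : 'rV[R]_n -> 'rV[R]_n) (ij : 'I_n.+1 * 'I_n) := g (p ij.1) ord0 ij.2.
apply: (@separated_finite _ _ _ _ F (C * (1 + `|x|) + r + `|x|) (e / 2)).
- by rewrite divr_gt0.
- move=> g [i j] [Pg gx]; rewrite /F /=.
  rewrite (le_trans (norm_coord _ _ _))//.
  have -> : g (p i) = (g (p i) - g x) + (g x - x) + x by rewrite -addrA subrK subrK.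
  rewrite (le_trans (ler_normD _ _))// lerD// (le_trans (ler_normD _ _))// lerD//.
  rewrite (le_trans (group_lip _ _ Pg))// ler_pM2l// (le_trans (ler_normB _ _))//.
  by rewrite lerD// p1.
move=> g h [Pg _] [Ph _] gh.
have ghp i : `|g (p i) - h (p i)| < e.
  apply: norm_row_lt => // j; rewrite !mxE; have := gh (i, j); rewrite /F /=.
  by move/lt_le_trans; apply; rewrite ler_pdivrMr// ler_peMr// ?ltW//; lra.
have [L gL] := group_affine Pg; have [L' hL] := group_affine Ph.
have pe j : p (lift ord0 j) = delta_mx 0 j by rewrite /p liftK.
have p0 : p ord0 = 0 by rewrite /p unlift_none.
have gh1 y : `|y| <= 1 -> C * `|g y - h y| < d.
  move=> y1.
  have E : g y - h y = (g 0 - h 0) + \sum_j y 0 j *: ((g (delta_mx 0 j) - h (delta_mx 0 j)) - (g 0 - h 0)).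
    have E (k : 'rV[R]_n -> 'rV[R]_n) (M : 'M[R]_n) : (forall x y, k y - k x = (y - x) *m M) ->
        k y = k 0 + \sum_j y 0 j *: (k (delta_mx 0 j) - k (0 : 'rV[R]_n)).
      move=> kM; rewrite -[LHS](subrK (k 0)) addrC kM subr0; congr (_ + _).
      rewrite {1}(row_sum_delta y) mulmx_suml; apply: eq_bigr => j _.
      by rewrite kM subr0 -scalemxAl.
    rewrite (E g L gL) (E h L' hL) opprD addrACA -sumrB; congr (_ + _).
    by apply: eq_bigr => j _; rewrite -scalerBr [in LHS]opprD addrACA -opprD.
  have : `|g y - h y| < n.*2.+1%:R * e.
    rewrite E (le_lt_trans (ler_normD _ _))// -natr1 mulrDl mul1r addrC.
    apply: ler_ltD; last by rewrite -p0 ghp.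
    apply: (le_trans (ler_norm_sum _ _ _)).
    apply: (@le_trans _ _ (\sum_(j < n) 2 * e)); last first.
      by rewrite sumr_const card_ord -[leLHS]mulr_natl -muln2 natrM mulrA.
    apply: ler_sum => j _; rewrite normrZ -[leRHS]mul1r ler_pM//.
      exact: le_trans (norm_coord _ _ _) y1.
    rewrite (le_trans (ler_normB _ _))// mulrDl mul1r.
    by rewrite lerD// ltW// -?pe -?p0 ghp.
  rewrite -(ltr_pM2l C0) => /lt_le_trans; apply.
  by rewrite mulrA /e mulrCA mulfV ?mulr1// gt_eqF// mulr_gt0.
have [k [Pk gk kg]] := group_inv Ph.
suff kgE : k \o g = id by apply: funext => y; rewrite -[g y]kg -[k (g y)]/((k \o g) y) kgE.
apply: dP; first exact: group_comp.
move=> y y1; rewrite /= -{2}[y]gk; rewrite (le_lt_trans (group_lip _ _ Pk))//.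
exact: gh1.
Qed.

End Group.

(** * Compact directions *)

Section Group.
Variables (R : realType) (n : nat) (Pi : set ('rV[R]_n -> 'rV[R]_n)).
Hypothesis hB : bieberbach Pi.

Let hG : isometry_group Pi. Proof. by case: hB. Qed.
Let hd : discrete_maps Pi. Proof. by case: hB. Qed.
Let C : R := Num.sqrt n.+1%:R.
Let C0 : 0 < C. Proof. by rewrite sqrtr_gt0 ltr0n. Qed.

(** The powers of an element fixing a point all have displacement 0 there, so
    they form a finite set and the element has finite order. *)
Lemma free_action g x : Pi g -> g x = x -> g = id.
Proof.
move=> Pg gx; case: hB => _ _ tf _.
have Pit i : Pi (iter i g).
  elim: i => [|i IHi]; first exact: group_id.
  by have -> : iter i.+1 g = g \o iter i g by []; exact: group_comp.
have [g' [_ gK _]] := group_inv hG Pg.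
have itx i : iter i g x = x by elim: i => //= i ->.
pose S := [set h | Pi h /\ `|h x - x| <= 0].
have Sf : finite_set S := bounded_displacement_finite hG hd x 0.
have [ninj|] := pselect (exists i j, (i < j)%N /\ iter i g = iter j g).
  have {ninj} [i [j [ij gij]]] := ninj.
  apply/funext; apply: (tf g (j - i)%N Pg); first by rewrite subn_gt0.
  move=> y; have itK : cancel (iter i g) (iter i g').
    by elim: i {ij gij} => // i IHi z; rewrite iterSr iterS gK.
  by apply: (can_inj itK); rewrite -iterD subnKC ?(ltnW ij)// gij.
move=> ninj; case: infinite_nat.
have -> : [set: nat] = (fun i => iter i g) @^-1` S.
  by apply/seteqP; split=> // i _; split; rewrite // itx subrr normr0.
apply: finite_preimage Sf => i j _ _ gij; apply/eqP.
case: (ltngtP i j) => // ij; case: ninj; first by exists i, j.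
by exists j, i.
Qed.

(** Only finitely many elements of Pi move y within distance 1 of z. *)
Lemma orbit_gap y z : exists2 e : R, 0 < e &
  forall g, Pi g -> g y != z -> e <= `|g y - z|.
Proof.
pose S := [set g | Pi g /\ `|g y - y| <= 1 + `|z - y|] `&` [set g | g y != z].
have Sf : finite_set S by apply: finite_setIl; exact: bounded_displacement_finite.
have [|e e0 eS] := @finite_set_gap R _ S (fun g => `|g y - z|) Sf.
  by move=> g [_ gyz]; rewrite normr_gt0 subr_eq0.
exists (Num.min e 1) => [|g Pg gyz]; first by rewrite lt_min e0/=.
rewrite ge_min; have [g1|/ltW->] := leP `|g y - z| 1; last by rewrite orbT.
rewrite eS//; split=> //; split=> //.
by rewrite -(subrK z (g y)) -addrA (le_trans (ler_normD _ _))// lerD2r.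
Qed.

Lemma cocompact_orbit x : exists r : R,
  forall y, exists2 g, Pi g & `|g y - x| <= r.
Proof.
case: hB => _ _ _ [K cK [cov _]].
have [M [_ MK]] := compact_bounded cK.
exists (M + 1 + `|x|) => y.
have : [set: 'rV[R]_n] y by [].
rewrite -cov => -[g Pg [k Kk <-]].
have [h [Ph gK _]] := group_inv hG Pg; exists h => //.
by rewrite gK (le_trans (ler_normB _ _))// lerD2r MK// ltrDl.
Qed.

(** A subspace is represented, here and below, as the row space of a square
    matrix. Stating invariance through differences of points avoids naming the
    linear part of g. *)
Definition invariant_dir (A : 'M[R]_n) :=
  forall g, Pi g -> forall x y, (y - x <= A)%MS -> (g y - g x <= A)%MS.

(** The stabilizer of x + A acts cocompactly on x + A: an element of Pi that sends
    one point of x + A into x + A preserves x + A when A is invariant. *)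
Definition cocompact_dir (A : 'M[R]_n) := forall x, exists r : R,
  forall y, (y - x <= A)%MS ->
  exists g, [/\ Pi g, (g y - x <= A)%MS & `|g y - x| <= r].

Definition compact_dir A := invariant_dir A /\ cocompact_dir A.

Lemma compact_dir0 : compact_dir 0.
Proof.
split=> [g _ x y|x].
  by rewrite !submx0 subr_eq0 => /eqP ->; rewrite subrr.
exists 0 => y yx; exists id; split=> //; first exact: group_id.
by move: yx; rewrite submx0 => /eqP ->; rewrite normr0.
Qed.

Lemma compact_dir1 : compact_dir 1%:M.
Proof.
split=> [g _ x y _|x]; first exact: submx1.
have [r hr] := cocompact_orbit x; exists r => y _.
by have [g Pg gy] := hr y; exists g; split; rewrite ?submx1.
Qed.

Lemma compact_dirD A B : compact_dir A -> compact_dir B -> compact_dir (A + B)%MS.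
Proof.
move=> [iA cA] [iB cB]; split=> [g Pg x y|x].
  move=> /sub_addsmxP[[u v] /= E].
  have -> : g y - g x = (g y - g (x + u *m A)) + (g (x + u *m A) - g x).
    by rewrite addrA subrK.
  rewrite addrC addmx_sub_adds//.
    by apply: iA => //; rewrite addrC addKr submxMl.
  by apply: iB => //; rewrite opprD addrA E addrAC subrr add0r submxMl.
have [r1 hr1] := cA x; have [r2 hr2] := cB x.
exists (C * r1 + r2) => y /sub_addsmxP[[u v] /= E].
set p := x + u *m A.
have [|g [Pg gA gr]] := hr1 p; first by rewrite addrC addKr submxMl.
set w := g y - g p.
have wB : (w <= B)%MS.
  by apply: iB => //; rewrite opprD addrA E addrAC subrr add0r submxMl.
have [|h [Ph hA hr]] := hr2 (x + w); first by rewrite addrC addKr.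
(* g y and x + w differ by the vector e = g p - x of A, of norm at most r1. *)
have gyE : g y - (x + w) = g p - x by row_ring.
exists (h \o g); split; first exact: group_comp.
  rewrite /= -(subrK (h (x + w)) (h (g y))) -addrA addmx_sub_adds//.
  by apply: iA => //; rewrite gyE.
rewrite /= -(subrK (h (x + w)) (h (g y))) -addrA (le_trans (ler_normD _ _))//.
by rewrite lerD// (le_trans (group_lip hG _ _ Ph))// ler_pM2l// gyE.
Qed.

(** Local finiteness of the translates g x + A near x: if z in g x + A is near x,
    then g^-1 z lies in x + A and some h brings it back near x within x + A.
    The element k = g h^-1 thus satisfies k x + A = g x + A, while its inverse
    moves z, a point near x, to a point near x; so k has bounded displacement
    at x. *)
Lemma translates_near x (A : 'M[R]_n) (rho : R) : compact_dir A ->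
  exists M, forall g z, Pi g -> (z - g x <= A)%MS -> `|z - x| <= rho ->
  exists k, [/\ Pi k, `|k x - x| <= M & (g x - k x <= A)%MS].
Proof.
move=> [iA cA]; have [r hr] := cA x.
exists (C * (C * rho + r)) => g z Pg zg zx.
have [g' [Pg' gK g'K]] := group_inv hG Pg.
have [|h [Ph hA hrx]] := hr (g' z).
  by rewrite -(gK x); exact: iA.
pose k := h \o g'; have Pk : Pi k by exact: group_comp.
have [k' [Pk' kK k'K]] := group_inv hG Pk.
exists k'; split=> //.
  rewrite -{2}(kK x) (le_trans (group_lip hG _ _ Pk'))// ler_pM2l// distrC.
  rewrite -(subrK (k z) (k x)) -addrA (le_trans (ler_normD _ _))// lerD//.
  by rewrite (le_trans (group_lip hG _ _ Pk))// ler_pM2l// distrC.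
rewrite -(subrK z (g x)) -addrA; apply: addmx_sub.
  by rewrite -opprB eqmx_opp.
by rewrite -(kK z); exact: iA.
Qed.

Lemma compact_dirI A B : compact_dir A -> compact_dir B -> compact_dir (A :&: B)%MS.
Proof.
move=> cdA cdB; have [[iA _] [iB _]] := (cdA, cdB).
have iAB : invariant_dir (A :&: B)%MS.
  by move=> g Pg x y; rewrite !sub_capmx => /andP[? ?]; rewrite iA ?iB.
split=> // x.
have [r0 hr0] := cocompact_orbit x.
have [MA hA] := translates_near x r0 cdA.
have [MB hB'] := translates_near x r0 cdB.
pose F M := [set k | Pi k /\ `|k x - x| <= M].
(* One element of Pi for each pair (k1, k2) such that some g x lies in both
   k1 x + A and k2 x + B. *)
pose good (k : ('rV[R]_n -> 'rV[R]_n) * ('rV[R]_n -> 'rV[R]_n)) g :=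
  [/\ Pi g, (g x - k.1 x <= A)%MS & (g x - k.2 x <= B)%MS].
have /choice[rep repP] : forall k, exists g, (exists g0, good k g0) -> good k g.
  by move=> k; case: (pselect (exists g0, good k g0)) => [[g0 ?]|?]; [exists g0|exists id].
have [M _ hM] : exists2 M : R, 0 <= M & forall k, (F MA `*` F MB) k -> `|rep k x - x| <= M.
  by apply: finite_set_bound; apply: finite_setX; exact: bounded_displacement_finite.
exists (C * (r0 + M)) => y yAB.
have [g Pg gy] := hr0 y.
have := iAB _ Pg _ _ yAB; rewrite sub_capmx => /andP[gA gB].
have [k1 [Pk1 k1M gk1]] := hA g (g y) Pg gA gy.
have [k2 [Pk2 k2M gk2]] := hB' g (g y) Pg gB gy.
have [|Pp pA pB] := repP (k1, k2); first by exists g.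
have := hM (k1, k2) (conj (conj Pk1 k1M) (conj Pk2 k2M)).
set p := rep (k1, k2) in Pp pA pB *; move=> pM; move: pA pB => /= pA pB.
have [p' [Pp' pK p'K]] := group_inv hG Pp.
have sb (D : 'M[R]_n) (k : 'rV[R]_n) : (g x - k <= D)%MS -> (p x - k <= D)%MS ->
    (g y - g x <= D)%MS -> (g y - p x <= D)%MS.
  move=> d1 d2 d3; have -> : g y - p x = (g y - g x) + ((g x - k) - (p x - k)).
    by row_ring.
  by apply: addmx_sub => //; apply: addmx_sub => //; rewrite eqmx_opp.
exists (p' \o g); split; first exact: group_comp.
  rewrite /= -[in X in _ - X](pK x); apply: iAB => //.
  by rewrite sub_capmx (sb _ (k1 x))//= (sb _ (k2 x)).
rewrite /= -[in X in _ - X](pK x) (le_trans (group_lip hG _ _ Pp'))// ler_pM2l//.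
rewrite -(subrK x (g y)) -addrA (le_trans (ler_normD _ _))// lerD//.
by rewrite distrC.
Qed.

End Group.

(** * Derivatives along lines *)

Section Calculus.
Variable R : realType.
Implicit Types V W : normedModType R.

Lemma mulmxr_continuous m n (B : 'M[R]_(m, n)) :
  continuous (fun u : 'rV[R]_m => u *m B).
Proof.
apply: (@bounded_linear_continuous R 'rV[R]_m 'rV[R]_n (mulmxr B)).
have [C C0 CB] := mulmx_bound B.
apply/linear_boundedP; near=> r => x /=.
rewrite (le_trans (CB x))// ler_wpM2r//.
Unshelve. all: by end_near. Qed.

Lemma Ck_cst V W k (U : set V) (b : W) : Ck k U (fun=> b).
Proof.
elim: k b => [b x _|k IHk b]; first exact: cst_continuous.
split=> [x _|v]; first exact: differentiable_cst.
suff -> : 'D_v (fun=> b) = (fun=> 0 : W) by exact: IHk.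
by apply/funext => x; rewrite derive_cst.
Qed.

Lemma affine_diff V W (f : V -> W) (l : {linear V -> W}) x : continuous l ->
  (forall x y, f y - f x = l (y - x)) ->
  differentiable f x /\ 'd f x = l :> (V -> W).
Proof.
move=> lc fl; have -> : f = cst (f 0) + l.
  by apply/funext => y; rewrite fctE /= -[y in l y]subr0 -fl addrC subrK.
have ld := linear_differentiable x lc.
have cd : differentiable (cst (f 0) : V -> W) x by exact: differentiable_cst.
split; first exact: (differentiableD cd ld).
by rewrite (diffD cd ld) diff_cst diff_lin//; apply/funext => v /=; rewrite add0r.
Qed.

Lemma affine_smooth V W (f : V -> W) (l : {linear V -> W}) (U : set V) :
  continuous l -> (forall x y, f y - f x = l (y - x)) -> smooth U f.
Proof.
move=> lc fl; case=> [|k].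
  by move=> x _; have [/differentiable_continuous + _] := affine_diff x lc fl.
split=> [x _|v]; first by have [] := affine_diff x lc fl.
suff -> : 'D_v f = (fun=> l v) by exact: Ck_cst.
by apply/funext => x; have [fd dE] := affine_diff x lc fl; rewrite deriveE// dE.
Qed.

Lemma line_derive V W (phi : V -> W) (l : {linear W -> R^o}) u w (t : R^o) :
  continuous l -> differentiable phi (u + t *: w) ->
  is_derive t 1 (fun s : R^o => l (phi (u + s *: w)) : R^o)
    (l ('d phi (u + t *: w) w)).
Proof.
move=> lc phid; pose a (s : R^o) := u + s *: w.
have ac : continuous ( *:%R^~ w : R^o -> V) by move=> s; exact: scalel_continuous.
have sl : linear ( *:%R^~ w : R^o -> V).
  by move=> b x y; rewrite scalerDl -scalerA.
pose sL := HB.pack_for {linear R^o -> V} ( *:%R^~ w : R^o -> V)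
  (GRing.isLinear.Build _ _ _ _ _ sl).
have [ad da] : differentiable a t /\ 'd a t = sL :> (R^o -> V).
  apply: affine_diff => // x y.
  by rewrite /a /= scalerBl opprD addrACA subrr add0r.
have ld : differentiable l (phi (a t)) by exact: linear_differentiable.
have pd : differentiable (phi \o a) t by exact: differentiable_comp.
have fd : differentiable (l \o (phi \o a)) t by exact: differentiable_comp.
apply: DeriveDef; first exact: diff_derivable.
rewrite (deriveE _ fd) (diff_comp pd ld) (diff_comp ad phid) /=.
by rewrite da (diff_lin _ lc) /= scale1r.
Qed.

(** The mean value theorem holds for scalar functions only, whence the
    functional l. *)
Lemma line_mvt V W (phi : V -> W) (l : {linear W -> R^o}) u w : continuous l ->
  (forall t : R, 0 <= t <= 1 -> differentiable phi (u + t *: w)) ->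
  exists2 t : R, 0 <= t <= 1 &
    l (phi (u + w)) - l (phi u) = l ('d phi (u + t *: w) w).
Proof.
move=> lc phid; pose f (s : R) : R := l (phi (u + s *: w)).
have fd (t : R) : 0 <= t <= 1 -> is_derive t 1 f (l ('d phi (u + t *: w) w)).
  by move=> /phid; exact: line_derive.
have [t||t t01 E] := @MVT R f (fun t => l ('d phi (u + t *: w) w)) 0 1 ltr01.
- by rewrite in_itv/= => /andP[t0 t1]; apply: fd; rewrite !ltW.
- apply: derivable_within_continuous => t t01.
  by case: (fd t); rewrite // -[_ && _]/(t \in `[0, 1]).
exists t; first by move: t01; rewrite in_itv/= => /andP[t0 t1]; rewrite !ltW.
by move: E; rewrite /f subr0 mulr1 scale0r addr0 scale1r.
Qed.

End Calculus.

(** * Immersions tangent to a subspace *)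

Section Immersion.
Variable R : realType.

Lemma mulmx_coord_linear n p (M : 'M[R]_(n, p)) i :
  exists2 l : {linear 'rV[R]_n -> R^o}, continuous l &
    forall v, l v = (v *m M) ord0 i.
Proof.
have sl : linear ((fun v => (v *m M) ord0 i) : 'rV[R]_n -> R^o).
  by move=> b x y; rewrite mulmxDl -scalemxAl !mxE.
have c : continuous (fun v : 'rV[R]_n => (v *m M) ord0 i : R).
  move=> x; apply: (@cvg_comp _ _ _ (fun v => v *m M) (fun B : 'rV[R]_p => B ord0 i)).
    exact: mulmxr_continuous.
  exact: coord_continuous.
by exists (HB.pack_for {linear 'rV[R]_n -> R^o} (fun v => (v *m M) ord0 i)
  (GRing.isLinear.Build _ _ _ _ _ sl)).
Qed.

(** The subspace A is cut out by the linear functionals given by the columns of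
    [cokermx A]; along the segment each of them, composed with phi, has zero
    derivative. *)
Lemma flat_displacement k n (phi : 'rV[R]_k -> 'rV[R]_n) (A : 'M[R]_n) u w :
  (forall t : R, 0 <= t <= 1 -> differentiable phi (u + t *: w) /\
     ('d phi (u + t *: w)%R w <= A)%MS) ->
  (phi (u + w)%R - phi u <= A)%MS.
Proof.
move=> H; rewrite submxE; apply/eqP/rowP => i; rewrite [RHS]mxE.
have [l lc lE] := mulmx_coord_linear (cokermx A) i.
have [t t01 E] := line_mvt lc (fun t t01 => proj1 (H t t01)).
rewrite mulmxBl !mxE; have := lE (phi (u + w)); have := lE (phi u).
rewrite !mxE => <- <-; rewrite E lE.
by have [_] := H t t01; rewrite submxE => /eqP ->; rewrite mxE.
Qed.

(** Row vectors form a Banach space, which the fixed point theorem requires. *)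
Definition complete_rV n := HB.pack_for (completeNormedModType R) 'rV[R]_n
  (Complete.class 'rV[R]_n) (NormedModule.class 'rV[R]_n).

(** A solution is a fixed point of w |-> b - h w, a contraction of the closed
    ball of radius r. *)
Lemma perturbed_identity_onto n (h : 'rV[R]_n -> 'rV[R]_n) (r : R) b :
  0 < r -> h 0 = 0 ->
  (forall w w', `|w| <= r -> `|w'| <= r -> `|h w - h w'| <= 2^-1 * `|w - w'|) ->
  `|b| <= r / 2 -> exists2 w, `|w| <= r & w + h w = b.
Proof.
move=> r0 h0 hl br.
pose U : set (complete_rV n) := closed_ball_ Num.Def.normr 0 r.
have UE w : U w <-> `|w| <= r by rewrite /U /closed_ball_ /= sub0r normrN.
pose G (w : complete_rV n) : complete_rV n := b - h w.
have GU : {homo G : x / U x >-> U x}.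
  move=> w /UE wr; apply/UE; rewrite /G (le_trans (ler_normB _ _))//.
  have := hl w 0 wr; rewrite normr0 h0 !subr0 => /(_ (ltW r0)) hw.
  by rewrite [leRHS](splitr r) lerD// (le_trans hw)// mulrC ler_pM2r.
have [|||w /UE wr wG] := @banach_fixed_point R (complete_rV n) U (mkfun_fun GU).
- exists (2^-1)%:nng; split; first by rewrite /= invf_lt1// ltr1n.
  move=> [w w'] /= [/UE wr /UE w'r].
  rewrite (_ : mkfun _ _ - mkfun _ _ = h w' - h w); last by rewrite /mkfun /G; row_ring.
  by rewrite distrC hl.
- exact: closed_closed_ball_.
- by exists 0; apply/UE; rewrite normr0 ltW.
by exists w => //; rewrite {1}wG /= /mkfun /G subrK.
Qed.

(** The inverse function theorem for phi seen as a map to phi u + A. Composing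
    with a left inverse T of the differential at u makes phi a small
    perturbation of the identity, to which [perturbed_identity_onto] applies;
    as phi stays in phi u + A, where T is injective, nothing is lost. *)
Lemma immersion_onto k n (phi : 'rV[R]_k -> 'rV[R]_n) (U W : set 'rV[R]_k)
    (A : 'M[R]_n) u : open U -> smooth U phi -> U u -> injective ('d phi u) ->
  (forall x, U x -> range ('d phi x) = [set v | (v <= A)%MS]) ->
  nbhs u W ->
  exists2 d : R, 0 < d & forall a, (a <= A)%MS -> `|a| < d ->
    exists w, [/\ W w, U w & phi w = phi u + a].
Proof.
move=> oU sphi Uu dinj dA Wu.
have phid x : U x -> differentiable phi x by case: (sphi 1%N) => + _; apply.
have phic v : {for u, continuous ('D_v phi)}.
  by case: (sphi 1%N) => _ /(_ v) /(_ u Uu).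
have [J JE] : exists J : 'M[R]_(k, n), forall v, 'd phi u v = v *m J.
  by exists (lin1_mx ('d phi u)) => v; rewrite mul_rV_lin1.
have Jfree : row_free J.
  by apply: inj_row_free => v; rewrite -JE -(linear0 ('d phi u)) => /dinj.
pose T := pinvmx J; have JT : J *m T = 1%:M by exact: mulmxVp.
have AT (v : 'rV[R]_n) : (v <= A)%MS -> (v *m T) *m J = v.
  move=> vA; have : range ('d phi u) v by rewrite dA.
  by move=> [c _ <-]; rewrite JE -(mulmxA c) JT mulmx1.
have [C C0 CT] := mulmx_bound T.
(* The k partial derivatives each contribute an error e. *)
pose e : R := (2 * k.+1%:R)^-1.
have e0 : 0 < e by rewrite invr_gt0 mulr_gt0.
pose dev (j : 'I_k) x := ('D_(delta_mx 0 j) phi x - 'D_(delta_mx 0 j) phi u) *m T.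
have nearD j : \forall x \near u, `|dev j x| < e.
  have : ('D_(delta_mx 0 j) phi x *m T) @[x --> u] --> 'D_(delta_mx 0 j) phi u *m T.
    by apply: (@cvg_comp _ _ _ _ (fun v => v *m T)); [exact: phic|exact: mulmxr_continuous].
  move=> /cvgrPdist_lt /(_ e e0); apply: filterS => x.
  by rewrite distrC -mulmxBl.
have {}nearD : \forall x \near u, forall j, `|dev j x| < e := filter_forall _ nearD.
have : \forall x \near u, [/\ U x, W x & forall j, `|dev j x| < e].
  by near=> x; split; near: x; [exact: open_nbhs_nbhs|exact: Wu|exact: nearD].
move=> /nbhs_ballP[r0 /= r00 ball_u].
pose r := r0 / 2; have rp : 0 < r by rewrite divr_gt0.
have rr0 : r < r0 by rewrite ltr_pdivrMr// ltr_pMr// ltr1n.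
have good w : `|w| <= r -> [/\ U (u + w), W (u + w) & forall j, `|dev j (u + w)| < e].
  move=> wr; apply: ball_u; rewrite -ball_normE /= opprD addNKr normrN.
  exact: le_lt_trans rr0.
pose h w := (phi (u + w) - phi u) *m T - w.
have hl w w' : `|w| <= r -> `|w'| <= r -> `|h w - h w'| <= 2^-1 * `|w - w'|.
  move=> wr w'r; pose q := w - w'.
  apply: norm_row_le => [|i]; first by rewrite mulr_ge0.
  have [l lc lE] := mulmx_coord_linear T i.
  have seg (t : R) : 0 <= t <= 1 -> `|w' + t *: q| <= r.
    move=> /andP[t0 t1]; have -> : w' + t *: q = (1 - t) *: w' + t *: w.
      by rewrite /q; row_ring.
    rewrite (le_trans (ler_normD _ _))// !normrZ !ger0_norm ?subr_ge0//.
    have : (1 - t) * `|w'| <= (1 - t) * r by rewrite ler_wpM2l ?subr_ge0.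
    have : t * `|w| <= t * r by rewrite ler_wpM2l.
    lra.
  have segU (t : R) : 0 <= t <= 1 -> differentiable phi (u + w' + t *: q).
    by rewrite -addrA => /seg/good[Ux _ _]; exact: phid.
  have [t t01] := @line_mvt R _ _ phi l (u + w') q lc segU.
  set x := u + w' + t *: q.
  have [Ux _ Dx] := good _ (seg t t01); rewrite addrA -/x in Ux Dx.
  rewrite -addrA (_ : w' + q = w); last by rewrite /q addrC subrK.
  move=> E; clearbody x.
  have dE y : U y -> l ('d phi y q) = \sum_j q 0 j * ('D_(delta_mx 0 j) phi y *m T) 0 i.
    move=> Uy; rewrite {1}(row_sum_delta q) !linear_sum; apply: eq_bigr => j _.
    by rewrite !linearZ -lE deriveE//; exact: phid.
  (* T inverts the differential at u. *)
  have lu : l ('d phi u q) = q 0 i by rewrite lE JE -mulmxA JT mulmx1.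
  have hE : (h w - h w') ord0 i = l (phi (u + w)) - l (phi (u + w')) - q 0 i.
    rewrite (lE (phi (u + w))) (lE (phi (u + w'))) /h /q !mulmxBl.
    move: (phi (u + w) *m T) (phi (u + w') *m T) (phi u *m T) => a a' a0.
    by rewrite !mxE; ring.
  have {}hE : (h w - h w') ord0 i = \sum_j q 0 j * ('D_(delta_mx 0 j) phi x *m T) 0 i -
      \sum_j q 0 j * ('D_(delta_mx 0 j) phi u *m T) 0 i.
    apply: (etrans hE); congr (_ - _); first exact: (etrans E (dE x Ux)).
    exact: (etrans (esym lu) (dE u Uu)).
  rewrite hE -sumrB (le_trans (ler_norm_sum _ _ _))//.
  apply: (@le_trans _ _ (\sum_(j < k) `|q| * e)).
    apply: ler_sum => j _; rewrite -mulrBr normrM ler_pM// ?norm_coord//.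
    have -> : ('D_('e_j) phi x *m T) 0 i - ('D_('e_j) phi u *m T) 0 i =
       (('D_('e_j) phi x - 'D_('e_j) phi u) *m T) 0 i by rewrite mulmxBl !mxE.
    exact: le_trans (norm_coord _ _ _) (ltW (Dx j)).
  rewrite sumr_const card_ord -[leLHS]mulr_natl mulrCA mulrC ler_wpM2r//.
  rewrite /e invfM mulrCA ler_piMr ?invr_ge0// ler_pdivrMr// mul1r ler_nat.
  exact: leqW.
exists (r / 2 / C) => [|a aA ad]; first by rewrite !divr_gt0.
have [||||w wr wE] := @perturbed_identity_onto k h r (a *m T) => //.
- by rewrite /h addr0 subrr mul0mx subrr.
- rewrite (le_trans (CT a))// mulrC -ler_pdivlMr//; exact: ltW.
have [Uw Ww _] := good _ wr.
exists (u + w); split=> //.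
have sA : (phi (u + w)%R - phi u <= A)%MS.
  apply: flat_displacement => t t01.
  have [|Ux _ _] := good (t *: w).
    move: t01 => /andP[t0 t1].
    by rewrite normrZ ger0_norm// (le_trans _ wr)// ler_piMl.
  split; first exact: phid.
  have dUx := dA _ Ux; move: ('d phi _) dUx => f fA.
  suff : [set v | (v <= A)%MS] (f w) by [].
  by rewrite -fA; exists w.
move: wE; rewrite /h addrC subrK => wE.
have := AT _ sA; rewrite wE (AT a aA) => ->.
by rewrite [RHS]addrC subrK.
Unshelve. all: by end_near.
Qed.

End Immersion.

(** * The image of an affine subspace in the quotient *)

Section LeafSpace.
Variables (R : realType) (n m : nat) (Pi : set ('rV[R]_n -> 'rV[R]_n)).
Variables (x : 'rV[R]_n) (B : 'M[R]_(m, n)).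

(** The points of E/Pi on the image of the affine subspace x + (row space of B).
    It carries the quotient topology of the parameter space, not the subspace
    topology of E/Pi. *)
Definition leaf_space : Type :=
  {s : set 'rV[R]_n | exists u : 'rV[R]_m, s = pi_orbit Pi (x + u *m B)}.

Definition leaf_proj (u : 'rV[R]_m) : leaf_space :=
  exist _ (pi_orbit Pi (x + u *m B)) (ex_intro _ u erefl).

Definition leaf_incl (p : leaf_space) : set 'rV[R]_n := sval p.

HB.instance Definition _ := gen_eqMixin leaf_space.
HB.instance Definition _ := gen_choiceMixin leaf_space.

Definition leaf_open (O : set leaf_space) := open (leaf_proj @^-1` O).

Program Definition leaf_topology :=
  @isOpenTopological.Build leaf_space leaf_open _ _ _.
Next Obligation. by rewrite /leaf_open preimage_setT; exact: openT. Qed.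
Next Obligation. by move=> ? ? ? ?; exact: openI. Qed.
Next Obligation. by move=> I f fo; apply: bigcup_open => i _; exact: fo. Qed.
HB.instance Definition _ := leaf_topology.
HB.instance Definition _ := isPointed.Build leaf_space (leaf_proj 0).

Lemma leaf_openE (O : set leaf_space) : open O = open (leaf_proj @^-1` O).
Proof. by []. Qed.

Lemma leaf_incl_inj : injective leaf_incl.
Proof. by move=> [s hs] [t ht] /= st; exact: eq_exist. Qed.

Lemma leaf_proj_surj p : exists u, leaf_proj u = p.
Proof. by case: p => s [u su]; exists u; apply: leaf_incl_inj. Qed.

Lemma leaf_proj_continuous : continuous leaf_proj.
Proof. by apply/continuousP => O; rewrite leaf_openE. Qed.

Lemma leaf_incl_range : range leaf_incl =
  [set s | exists u : 'rV[R]_m, s = pi_orbit Pi (x + u *m B)].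
Proof.
by apply/seteqP; split=> [_ [[s hs] _ <-] //|s hs]; exists (exist _ s hs).
Qed.

Lemma leaf_connected : connected [set: leaf_space].
Proof.
have -> : [set: leaf_space] =
    \bigcup_(v in [set: 'rV[R]_m]) (fun t : R => leaf_proj (t *: v)) @` `[0, 1]%classic.
  apply/seteqP; split=> // p _; have [u <-] := leaf_proj_surj p.
  by exists u => //; exists 1; rewrite ?scale1r//= in_itv /= ler01 lexx.
apply: bigcup_connected.
  exists (leaf_proj 0) => v _; exists 0; rewrite ?scale0r//= in_itv /= ler01 lexx.
  by [].
move=> v _; apply: connected_continuous_connected; first exact: segment_connected.
apply: continuous_subspaceT => t.
apply: (@cvg_comp _ _ _ (fun t : R => t *: v) leaf_proj).
  exact: scalel_continuous.
exact: leaf_proj_continuous.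
Qed.

End LeafSpace.

Section Leaf.
Variables (R : realType) (n : nat) (Pi : set ('rV[R]_n -> 'rV[R]_n)).
Hypothesis hB : bieberbach Pi.

Let hG : isometry_group Pi. Proof. by case: hB. Qed.
Let C : R := Num.sqrt n.+1%:R.

Lemma pi_orbitP y z : pi_orbit Pi y = pi_orbit Pi z <-> exists2 g, Pi g & g y = z.
Proof.
split=> [E|[g Pg gy]].
  have : pi_orbit Pi z z by exists id => //; exact: group_id.
  by rewrite -E => -[g Pg gy]; exists g.
have [h [Ph gK hK]] := group_inv hG Pg.
apply/seteqP; split=> _ [k Pk <-].
  by exists (k \o h); [exact: group_comp|rewrite /= -gy gK].
by exists (k \o g); [exact: group_comp|rewrite /= gy].
Qed.

Variables (A : 'M[R]_n) (x : 'rV[R]_n).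
Hypothesis iA : invariant_dir Pi A.

Variables (m : nat) (B : 'M[R]_(m, n)).
Hypotheses (B_free : row_free B) (eqBA : (B :=: A)%MS).
Let T := pinvmx B.
Let q : 'rV[R]_m -> leaf_space Pi x B := leaf_proj Pi x B.
Let phi (u : 'rV[R]_m) := x + u *m B.

Let BT : B *m T = 1%:M. Proof. exact: mulmxVp. Qed.

Lemma base_sub (v : 'rV[R]_n) : (v <= A)%MS -> v = (v *m T) *m B.
Proof.
by rewrite -eqBA => /submxP[c ->]; rewrite -(mulmxA c) BT mulmx1.
Qed.

Lemma mul_base_sub (u : 'rV[R]_m) : (u *m B <= A)%MS.
Proof. by rewrite -eqBA submxMl. Qed.

Lemma base_inj (u v : 'rV[R]_m) : u *m B = v *m B -> u = v.
Proof. by move=> /(congr1 (mulmx^~ T)); rewrite -!mulmxA BT !mulmx1. Qed.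

Lemma leaf_projP u v : q u = q v <-> exists2 g, Pi g & g (phi u) = phi v.
Proof.
rewrite -pi_orbitP; split=> [/(congr1 (@leaf_incl _ _ _ _ _ _))//|E].
exact: leaf_incl_inj.
Qed.

(** If h in Pi maps a point of x + A to a point of x + A, its inverse g acts on the
    parameters by an affine, hence continuous, map, because A is invariant. *)
Lemma leaf_proj_open O : open O -> open (q @` O).
Proof.
move=> oO; rewrite leaf_openE openE => u [u' Ou' /leaf_projP[h Ph hE]].
have [g [Pg hK gK]] := group_inv hG Ph.
have [L gL] := group_affine hG Pg.
have gE v : g (phi v) = phi (u' + (v - u) *m (B *m L *m T)).
  have phiB : phi v - phi u = (v - u) *m B.
    by rewrite /phi opprD addrACA subrr add0r -mulmxBl.
  have dB : (g (phi v) - g (phi u) <= A)%MS.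
    by apply: iA => //; rewrite phiB; exact: mul_base_sub.
  have -> : (v - u) *m (B *m L *m T) = (g (phi v) - g (phi u)) *m T.
    by rewrite gL phiB !mulmxA.
  by rewrite {2}/phi mulmxDl -base_sub// addrA -/(phi u') -hE hK addrC subrK.
have c : continuous (fun v : 'rV[R]_m => u' + (v - u) *m (B *m L *m T)).
  move=> v; apply: (@affine_smooth _ _ _ _ (mulmxr (B *m L *m T)) setT _ _ 0%N) => //.
    exact: mulmxr_continuous.
  by move=> y z; rewrite opprD addrACA subrr add0r -mulmxBl opprB addrA subrK.
have : nbhs u ((fun v : 'rV[R]_m => u' + (v - u) *m (B *m L *m T)) @^-1` O).
  by apply: c; rewrite subrr mul0mx addr0; exact: open_nbhs_nbhs.
apply: filterS => v Ov; exists (u' + (v - u) *m (B *m L *m T)) => //.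
by apply/esym/leaf_projP; exists g; rewrite ?gE.
Qed.

Lemma phi_near (e : R) : 0 < e -> exists2 d : R, 0 < d &
  forall u v, `|u - v| < d -> `|phi u - phi v| < e.
Proof.
have [K K0 KB] := mulmx_bound B.
move=> e0; exists (e / K) => [|u v uv]; first exact: divr_gt0.
rewrite /phi opprD addrACA subrr add0r -mulmxBl (le_lt_trans (KB _))//.
by rewrite mulrC -ltr_pdivlMr.
Qed.

(** By [orbit_gap]: if g moves phi u away from phi v, it moves it away by a fixed
    amount, and so it moves no point near phi u onto a point near phi v. With
    u = v this gives local injectivity of the projection, and for u, v in
    different orbits the Hausdorff property. *)
Lemma leaf_orbits_separated u v : exists2 d : R, 0 < d &
  forall u' v' g, `|u - u'| < d -> `|v - v'| < d -> Pi g -> g (phi u') = phi v' ->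
    g (phi u) = phi v.
Proof.
have [e e0 he] := orbit_gap hB (phi u) (phi v).
have C0 : 0 < C by rewrite sqrtr_gt0 ltr0n.
have [d d0 hd] := phi_near (divr_gt0 e0 (addr_gt0 C0 ltr01)).
exists d => // u' v' g uu' vv' Pg gE; apply/eqP/negPn/negP => ne.
have := he g Pg ne; apply/negP; rewrite -ltNge.
have -> : g (phi u) - phi v = (g (phi u) - g (phi u')) + (phi v' - phi v).
  by rewrite gE addrA subrK.
rewrite (le_lt_trans (ler_normD _ _))//.
have h1 := hd _ _ uu'; have h2 := hd _ _ vv'.
have h3 := group_lip hG (phi u) (phi u') Pg; rewrite -/C in h3.
rewrite (distrC (phi v')).
set E := e / (C + 1) in h1 h2.
have -> : e = C * E + E.
  by rewrite -[X in _ + X]mul1r -mulrDl mulrC divfK// gt_eqF// addr_gt0.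
by rewrite ler_ltD// (le_trans h3)// ler_pM2l// ltW.
Qed.

Lemma leaf_proj_locally_inj (u : 'rV[R]_m) : exists2 d : R, 0 < d &
  {in (ball u d : set 'rV[R]_m) &, injective q}.
Proof.
have [d d0 hd] := leaf_orbits_separated u u.
exists d => // u' v'; rewrite !inE -!ball_normE /= => uu' uv'.
move=> /leaf_projP[g Pg gE].
have gid : g = id by exact: (free_action hB Pg (hd _ _ _ uu' uv' Pg gE)).
by move: gE; rewrite gid => /addrI/base_inj.
Qed.

Lemma leaf_hausdorff : hausdorff_space (leaf_space Pi x B).
Proof.
rewrite open_hausdorff => p1 p2.
have [u <-] := leaf_proj_surj p1; have [v <-] := leaf_proj_surj p2.
move=> /eqP ne; have [d d0 hd] := leaf_orbits_separated u v.
exists (q @` ball u d, q @` ball v d) => /=.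
  by rewrite !inE; split; [exists u|exists v] => //; exact: ballxx.
split; [exact/leaf_proj_open/ball_open|exact/leaf_proj_open/ball_open|].
apply/eqP/seteqP; split=> // _ [[u' uu' <-] [v' vv' /esym/leaf_projP[g Pg gE]]].
rewrite -!ball_normE /= in uu' vv'.
by apply: ne; apply/leaf_projP; exists g => //; exact: hd gE.
Qed.

(** The images of balls with rational centres and radii 1/(N+1); the projection
    being open, they are open. *)
Lemma leaf_second_countable : @second_countable (leaf_space Pi x B).
Proof.
pose b (i : 'rV[rat]_m * nat) := q @` ball (map_mx ratr i.1 : 'rV[R]_m) (i.2.+1%:R^-1 : R).
exists (range b); first exact: sub_countable (card_image_le b setT) (countableP _).
split=> [_ [i _ <-]|p O Op]; first exact/leaf_proj_open/ball_open.
have [u up] := leaf_proj_surj p; rewrite -up in Op.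
have /nbhs_ballP[e /= e0 eO] := leaf_proj_continuous Op.
have [N hN] : exists N : nat, N.+1%:R^-1 < e / 2.
  have e2 : 0 < e / 2 by rewrite divr_gt0.
    have := near_infty_natSinv_lt (PosNum e2).
    by move=> /filter_ex[N hN]; exists N.
have N0 : 0 < N.+1%:R^-1 :> R by rewrite invr_gt0.
have /choice[r hr] : forall i : 'I_m, exists s : rat, `|u 0 i - ratr s| < N.+1%:R^-1.
  move=> i; move: N.+1%:R^-1 N0 => eps eps0.
  have : u 0 i - eps < u 0 i + eps by lra.
  move=> /rat_in_itvoo[s]; rewrite in_itv /= => /andP[s1 s2]; exists s.
  by rewrite ltr_norml; apply/andP; split; lra.
pose c : 'rV[R]_m := map_mx ratr (\row_i r i).
have uc : ball c (N.+1%:R^-1) u.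
  rewrite -ball_normE /= distrC; apply: norm_row_lt => // i; rewrite !mxE.
  exact: hr.
exists (b (\row_i r i, N)).
  by split; [exists (\row_i r i, N)|rewrite -up; exists u].
move=> _ [v cv <-]; apply: eO; apply: (@le_ball _ _ _ (N.+1%:R^-1 + N.+1%:R^-1)).
  by rewrite ltW// [ltRHS]splitr ltrD.
exact: (ball_triangle (ball_sym uc) cv).
Qed.

Lemma leaf_integral (D : 'rV[R]_n -> set 'rV[R]_n) :
  (forall y, D y = [set v | (v <= A)%MS]) ->
  connected_integral_manifold Pi D (@leaf_incl R n m Pi x B).
Proof.
move=> DE; split; last by exists (q 0).
  split; [exact: leaf_hausdorff|exact: leaf_second_countable|exact: leaf_incl_inj|].
  exists m => p; have [u0 <-] := leaf_proj_surj p.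
  have [d d0 dinj] := leaf_proj_locally_inj u0.
  have fl y z : phi z - phi y = mulmxr B (z - y).
    by rewrite /phi opprD addrACA subrr add0r -mulmxBl.
  have cB : continuous (mulmxr B : 'rV[R]_m -> 'rV[R]_n) by exact: mulmxr_continuous.
  have dE u : 'd phi u = mulmxr B :> ('rV[R]_m -> 'rV[R]_n).
    by have [] := affine_diff u cB fl.
  exists (ball u0 d), phi, q; split.
  - exact: ball_open.
  - by exists u0 => //; exact: ballxx.
  - split=> // [u _|O oO _]; first exact: leaf_proj_continuous.
    exact: leaf_proj_open.
  - by [].
  split=> [|u _|u _]; first exact: affine_smooth cB fl.
    by rewrite dE => v w; exact: base_inj.
  rewrite dE DE; apply/seteqP; split=> [_ [v _ <-]|v /= vA]; first exact: mul_base_sub.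
  by exists (v *m T) => //=; rewrite -base_sub.
exact: leaf_connected.
Qed.

End Leaf.

(** * Leaves and their compactness *)

Section Compact.
Variables (R : realType) (n : nat) (Pi : set ('rV[R]_n -> 'rV[R]_n)).
Hypothesis hB : bieberbach Pi.
Variables (A : 'M[R]_n) (D : 'rV[R]_n -> set 'rV[R]_n).
Hypothesis iA : invariant_dir Pi A.
Hypothesis DE : forall y, D y = [set v | (v <= A)%MS].

Let hG : isometry_group Pi. Proof. by case: hB. Qed.

Definition leaf_points (x : 'rV[R]_n) : set (set 'rV[R]_n) :=
  [set s | exists2 y, (y - x <= A)%MS & s = pi_orbit Pi y].

(** An element g of Pi that brings y into x + A brings y + A into x + A. *)
Lemma leaf_points_step x y z : (z - y <= A)%MS ->
  leaf_points x (pi_orbit Pi y) -> leaf_points x (pi_orbit Pi z).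
Proof.
move=> zy [y' y'x /(pi_orbitP hB)[g Pg gy]]; exists (g z).
  have -> : g z - x = (g z - g y) + (y' - x) by rewrite gy addrA subrK.
  by apply: addmx_sub => //; exact: iA.
by apply/(pi_orbitP hB); exists g.
Qed.

Lemma chart_flat k (phi : 'rV[R]_k -> 'rV[R]_n) (U : set 'rV[R]_k) u :
  open U -> smooth U phi -> (forall u, U u -> range ('d phi u) = D (phi u)) ->
  U u -> exists2 d : R, 0 < d & forall u', ball u d u' ->
    U u' /\ (phi u' - phi u <= A)%MS.
Proof.
move=> oU sphi rphi Uu.
have /nbhs_ballP[d /= d0 dU] : nbhs u U by exact: open_nbhs_nbhs.
exists d => // u' uu'; split; first exact: dU.
have -> : u' = u + (u' - u) by rewrite addrC subrK.
apply: flat_displacement => t /andP[t0 t1].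
have Ut : U (u + t *: (u' - u)).
  apply: dU; move: uu'; rewrite -!ball_normE /= opprD addNKr normrN normrZ ger0_norm//.
  by rewrite (distrC u'); apply: le_lt_trans; rewrite ler_piMl.
split; first by case: (sphi 1%N) => + _; apply.
have := rphi _ Ut; move: ('d phi _) => f; rewrite DE => fA.
suff : [set v | (v <= A)%MS] (f (u' - u)) by [].
by rewrite -fA; exists (u' - u).
Qed.

(** Within a chart the manifold moves inside a translate of A, so lying on
    the image of x + A is a locally constant property of its points. *)
Lemma integral_in_leaf (N : topologicalType) (j : N -> set 'rV[R]_n) x p0 :
  connected_integral_manifold Pi D j -> j p0 = pi_orbit Pi x ->
  range j `<=` leaf_points x.
Proof.
move=> [[_ _ _ [k charts]] conn _] jp0.
pose S := j @^-1` leaf_points x.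
have step p : exists2 W, nbhs p W & forall p', W p' -> S p' <-> S p.
  have [U [phi [psi [oU [u Uu <-] [_ _ opsi] jpsi [sphi _ rphi]]]]] := charts p.
  have [d d0 dP] := chart_flat oU sphi rphi Uu.
  exists (psi @` ball u d).
    apply: open_nbhs_nbhs; split; last by exists u => //; exact: ballxx.
    by apply: opsi; [exact: ball_open|move=> v /dP[]].
  move=> _ [u' /dP[Uu' uu'] <-]; rewrite /S /preimage /= !jpsi//.
  split; apply: leaf_points_step => //.
  by rewrite -opprB eqmx_opp.
have oS : open S.
  rewrite openE => p Sp; have [W Wp WS] := step p.
  by apply: filterS Wp => p' /WS ->.
have cS : closed S.
  rewrite -[S]setCK; apply: open_closedC.
  rewrite openE => p Sp; have [W Wp WS] := step p.
  by apply: filterS Wp => p' /WS SE /SE.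
have ST : S = setT.
  apply: conn; last by exists S; rewrite ?setTI.
    by exists p0; rewrite /S /preimage /= jp0; exists x; rewrite // subrr sub0mx.
  by exists S; rewrite ?setTI.
by move=> _ [p _ <-]; have : S p by rewrite ST.
Qed.

Let B := row_base A.
Let B_free : row_free B := row_base_free A.
Let eqBA : (B :=: A)%MS := eq_row_base A.

Lemma leaf_incl_points x : range (@leaf_incl R n _ Pi x B) = leaf_points x.
Proof.
rewrite leaf_incl_range; apply/seteqP; split=> s.
  by move=> [u ->]; exists (x + u *m B) => //; rewrite addrC addKr; exact: mul_base_sub.
move=> [y yx ->]; exists ((y - x) *m pinvmx B); rewrite -(base_sub B_free eqBA yx).
by rewrite addrC subrK.
Qed.

(** Maximality: any larger connected integral manifold passes through x, so
    [integral_in_leaf] confines it. *)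
Lemma leaf_space_leaf x : leaf Pi D (@leaf_incl R n _ Pi x B).
Proof.
split; first exact: (leaf_integral hB x iA B_free eqBA).
move=> N' j' cj' sub; apply/seteqP; split=> //.
rewrite leaf_incl_points.
have [p0 _ jp0] : range j' (pi_orbit Pi x).
  by apply: sub; rewrite leaf_incl_points; exists x; rewrite // subrr sub0mx.
exact: integral_in_leaf jp0.
Qed.

(** A leaf is contained in some [leaf_space], which is a connected integral
    manifold, so it fills it by maximality. *)
Lemma leaf_range (N : topologicalType) (j : N -> set 'rV[R]_n) : leaf Pi D j ->
  exists x, range j = leaf_points x.
Proof.
move=> [cj jmax]; have [[_ _ _ [k charts]] _ [p _]] := cj.
have [U [phi [psi [_ [u Uu up] _ jpsi _]]]] := charts p.
exists (phi u); rewrite -leaf_incl_points; apply/esym/jmax.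
  exact: (leaf_integral hB _ iA B_free eqBA).
by rewrite leaf_incl_points; apply: (integral_in_leaf (p0 := p)) => //; rewrite -up jpsi.
Qed.

(** The images of the balls of the parameter space form an increasing open cover
    of the leaf through x, so one of them is the whole leaf. *)
Lemma compact_leaves_cocompact : compact_leaves Pi D -> cocompact_dir Pi A.
Proof.
move=> cl x; have cc : cover_compact [set: leaf_space Pi x B].
  by rewrite -compact_cover; exact: cl (leaf_space_leaf x).
pose q := leaf_proj Pi x B.
have [|p _|F _ Fcov] := cc nat setT (fun k => q @` ball 0 k.+1%:R).
- by move=> k _; apply: (leaf_proj_open hB iA B_free eqBA); exact: ball_open.
- have [u <-] := leaf_proj_surj p.
  exists (Num.truncn `|u|) => //; exists u => //.
  by rewrite -ball_normE /= sub0r normrN truncnS_gt.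
have [M M0 FM] := finite_set_bound (fun k : nat => k.+1%:R : R) (finite_fset F).
have [K K0 KB] := mulmx_bound B.
exists (K * M) => y yx.
have [k Fk [u' u'k qu']] := Fcov (q ((y - x) *m pinvmx B)) I.
have /esym/(leaf_projP hB)[g Pg gE] := qu'.
rewrite -(base_sub B_free eqBA yx) addrC subrK in gE.
exists g; rewrite gE addrC addKr; split=> //; first exact: mul_base_sub.
rewrite (le_trans (KB _))// ler_pM2l// (le_trans _ (FM k Fk))//.
by move: u'k; rewrite -ball_normE /= sub0r normrN => /ltW.
Qed.

(** The leaf N is the image of x + A under the map F that sends u to the point of
    N lying over x + u B. F is continuous: near a given point, [immersion_onto]
    lifts F to a chart of N. Cocompactness says that a closed ball suffices. *)
Lemma cocompact_compact_leaves : cocompact_dir Pi A -> compact_leaves Pi D.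
Proof.
move=> cA N j lj; have [x jx] := leaf_range lj.
have [[[_ _ jinj [k charts]] _ _] _] := lj.
have /choice[F FE] : forall u : 'rV[R]_(\rank A), exists p, j p = pi_orbit Pi (x + u *m B).
  move=> u; have : leaf_points x (pi_orbit Pi (x + u *m B)).
    by exists (x + u *m B) => //; rewrite addrC addKr; exact: mul_base_sub.
  by rewrite -jx => -[p _ <-]; exists p.
have cF : continuous F.
  move=> u O /=.
  have [U [phi [psi [oU [w Uw wE] [_ cpsi _] jpsi [sphi iphi rphi]]]]] := charts (F u).
  rewrite -wE => Ow.
  have rA w' : U w' -> range ('d phi w') = [set v | (v <= A)%MS].
    by move=> /rphi ->; rewrite DE.
  have [d d0 hd] := immersion_onto oU sphi Uw (iphi _ Uw) rA (cpsi _ Uw _ Ow).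
  have /esym/(pi_orbitP hB)[g Pg gE] : pi_orbit Pi (phi w) = pi_orbit Pi (x + u *m B).
    by rewrite -FE -wE jpsi.
  have [d' d'0 hd'] := phi_near x B (divr_gt0 d0 (ltr_wpDr (sqrtr_ge0 n.+1%:R) ltr01)).
  apply/nbhs_ballP; exists d' => //= u'; rewrite -ball_normE /= => uu'.
  set y := x + u *m B in gE; set y' := x + u' *m B.
  have yy' : (g y' - g y <= A)%MS.
    apply: iA => //; rewrite /y /y' opprD addrACA subrr add0r -mulmxBl.
    exact: mul_base_sub.
  have [|w' [Ow' Uw' pw']] := hd _ yy'.
    rewrite (le_lt_trans (group_lip hG _ _ Pg))//.
    have := hd' _ _ uu'; rewrite -/y -/y' distrC.
    rewrite ltr_pdivlMr; last by rewrite ltr_wpDr ?sqrtr_ge0.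
    by apply: le_lt_trans; rewrite [leRHS]mulrC ler_wpM2r// lerDr.
  rewrite /preimage /= (_ : F u' = psi w')//; apply: jinj.
  rewrite FE jpsi// pw' -gE (addrC (g y)) subrK; apply/(pi_orbitP hB).
  by exists g.
have [r hr] := cA x.
have [K K0 KT] := mulmx_bound (pinvmx B).
have -> : [set: N] = F @` [set u | `|u| <= K * r].
  apply/seteqP; split=> // p _.
  have : leaf_points x (j p) by rewrite -jx; exists p.
  move=> [y /hr[g [Pg gA gr]] jp].
  exists ((g y - x) *m pinvmx B) => /=.
    by rewrite (le_trans (KT _))// ler_pM2l.
  apply: jinj; rewrite FE -(base_sub B_free eqBA gA) addrC subrK jp.
  by apply/esym/(pi_orbitP hB); exists g.
apply: continuous_compact; first exact: continuous_subspaceT.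
have -> : [set u : 'rV[R]_(\rank A) | `|u| <= K * r] = closed_ball_ Num.norm 0 (K * r).
  by apply/seteqP; split=> u; rewrite /closed_ball_ /= sub0r normrN.
apply: bounded_closed_compact; last exact: closed_closed_ball_.
exists (K * r); split; first exact: num_real.
move=> M Mr u; rewrite /closed_ball_ /= sub0r normrN => ur.
exact: le_trans ur (ltW Mr).
Qed.

End Compact.

(** * Subspaces, parallel distributions and families *)

Section Subspaces.
Variables (R : realType) (n : nat).

Lemma max_rank_mx (P : 'M[R]_n -> Prop) A0 : P A0 ->
  exists2 A, P A & forall A', P A' -> (A <= A')%MS -> (A' <= A)%MS.
Proof.
move=> PA0; pose Q r := `[< exists2 A, P A & \rank A = r >].
have Q0 : exists r, Q r by exists (\rank A0); apply/asboolP; exists A0.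
have Qn r : Q r -> (r <= n)%N by move=> /asboolP[A _ <-]; exact: rank_leq_row.
case: (ex_maxnP Q0 Qn) => r /asboolP[A PA rA] rmax; exists A => // A' PA' AA'.
rewrite -(mxrank_leqif_sup AA') eqn_leq mxrankS//= rA.
by apply: rmax; apply/asboolP; exists A'.
Qed.

Lemma min_rank_mx (P : 'M[R]_n -> Prop) A0 : P A0 ->
  exists2 A, P A & forall A', P A' -> (A' <= A)%MS -> (A <= A')%MS.
Proof.
move=> PA0; pose Q r := `[< exists2 A, P A & \rank A = r >].
have Q0 : exists r, Q r by exists (\rank A0); apply/asboolP; exists A0.
case: (ex_minnP Q0) => r /asboolP[A PA rA] rmin; exists A => // A' PA' AA'.
rewrite -(mxrank_leqif_sup AA') eqn_leq mxrankS//= rA.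
by apply: rmin; apply/asboolP; exists A'.
Qed.

(** A matrix of maximal rank among those with rows in S. *)
Lemma subspace_mx (S : set 'rV[R]_n) : S 0 ->
  (forall a u v, S u -> S v -> S (a *: u + v)) ->
  exists A : 'M[R]_n, S = [set v | (v <= A)%MS].
Proof.
move=> S0 SP.
have [|A AS Amax] := @max_rank_mx (fun A => forall v : 'rV_n, (v <= A)%MS -> S v) 0.
  by move=> v; rewrite submx0 => /eqP ->.
exists A; apply/seteqP; split=> v //=; last exact: AS.
move=> Sv; have vAv : (v <= A + <<v>>)%MS.
  by apply: submx_trans (addsmxSr A _); rewrite genmxE.
apply: (submx_trans vAv); apply: Amax; last exact: addsmxSl.
move=> w /sub_addsmxP[[a b] /= ->]; rewrite addrC.
have /sub_rVP[c ->] : (b *m <<v>> <= v)%MS by rewrite -(genmxE v) submxMl.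
by apply: SP => //; apply: AS; exact: submxMl.
Qed.

End Subspaces.

Section Parallel.
Variables (R : realType) (n : nat) (Pi : set ('rV[R]_n -> 'rV[R]_n)).
Hypothesis hB : bieberbach Pi.
Implicit Types D : 'rV[R]_n -> set 'rV[R]_n.

Let hG : isometry_group Pi. Proof. by case: hB. Qed.

Lemma line_smooth (x v : 'rV[R]_n) : smooth setT (fun t : R^o => x + t *: v).
Proof.
have sl : linear ( *:%R^~ v : R^o -> 'rV[R]_n).
  by move=> b s t; rewrite scalerDl -scalerA.
apply: (@affine_smooth _ _ _ _ (HB.pack_for {linear R^o -> 'rV[R]_n}
  ( *:%R^~ v : R^o -> 'rV[R]_n) (GRing.isLinear.Build _ _ _ _ _ sl))) => [t|s t].
  exact: scalel_continuous.
by rewrite opprD addrACA subrr add0r -scalerBl.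
Qed.

(** A constant vector field is parallel along the segment from x to y. *)
Lemma parallel_constant D x y : parallel D -> D x = D y.
Proof.
move=> pD; apply/seteqP; split=> v.
  have := pD _ (fun=> v) (line_smooth x (y - x)).
  rewrite scale0r addr0 scale1r (addrC x) subrK => /(_ _)[]//.
  by move=> t _; exact: is_derive_cst.
have := pD _ (fun=> v) (line_smooth y (x - y)).
rewrite scale0r addr0 scale1r (addrC y) subrK => /(_ _)[]//.
by move=> t _; exact: is_derive_cst.
Qed.

Lemma constant_parallel D : (forall x y, D x = D y) -> parallel D.
Proof.
move=> cD c X _ dX; rewrite (cD (c 1) (c 0)); suff -> : X 1 = X 0 by [].
apply/eqP; rewrite -subr_eq0; apply/eqP/rowP => i.
have [l lc lE] := mulmx_coord_linear (1%:M : 'M[R]_n) i.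
have Xd (t : R) : 0 <= t <= 1 -> differentiable X (0 + t *: (1 : R^o)).
  move=> t01; apply/derivable1_diffP; rewrite add0r [_ *: _]mulr1.
  by have [] := dX t t01.
have [t t01] := line_mvt lc Xd.
rewrite add0r !lE -(deriveE _ (Xd t t01)) add0r [_ *: _]mulr1.
have [_ ->] := dX t t01.
by rewrite !mulmx1 !mxE.
Qed.

Lemma group_diff g x : Pi g ->
  exists2 L : 'M[R]_n, (forall x y, g y - g x = (y - x) *m L) &
    'd g x = (fun v => v *m L) :> ('rV[R]_n -> 'rV[R]_n).
Proof.
move=> Pg; have [L gL] := group_affine hG Pg; exists L => //.
by have [] := @affine_diff _ _ _ g (mulmxr L) x (@mulmxr_continuous _ _ _ L) gL.
Qed.

Lemma parallel_compact_dir D : parallel_distribution_with_compact_leaves Pi D ->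
  exists2 A : 'M[R]_n, compact_dir Pi A & forall y, D y = [set v | (v <= A)%MS].
Proof.
move=> [[invD [k subb]] pD clD].
have [A DA] : exists A : 'M[R]_n, D 0 = [set v | (v <= A)%MS].
  have [U [e [_ U0 _ eD]]] := subb 0; have [_ ->] := eD _ U0.
  apply: subspace_mx => [|a u v /= uX vX]; first exact: mem0v.
  by rewrite memvD ?memvZ.
have DE y : D y = [set v | (v <= A)%MS] by rewrite (parallel_constant y 0).
have iA : invariant_dir Pi A.
  move=> g Pg x y yx; have [L gL dg] := group_diff x Pg.
  suff : D (g x) (g y - g x) by rewrite DE.
  by rewrite (invD g Pg) dg gL; exists (y - x); rewrite // DE.
exists A => //; split=> //.
exact: (compact_leaves_cocompact hB iA DE).
Qed.

Lemma compact_dir_parallel D (A : 'M[R]_n) : compact_dir Pi A ->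
  (forall y, D y = [set v | (v <= A)%MS]) ->
  parallel_distribution_with_compact_leaves Pi D.
Proof.
move=> [iA cA] DE; split; first last.
- exact: (cocompact_compact_leaves hB iA DE).
- by apply: constant_parallel => x y; rewrite !DE.
split.
  move=> g Pg x; rewrite !DE; have [L gL ->] := group_diff x Pg.
  have [h [Ph gK hK]] := group_inv hG Pg.
  apply/seteqP; split=> [v /= vA|_ [v /= vA <-]].
    have E : g x + v - g x = v by rewrite addrC addKr.
    exists (h (g x + v) - x); last by rewrite -gL hK.
    by rewrite -{2}(gK x); apply: iA => //; rewrite E.
  have -> : v *m L = g (x + v) - g x by rewrite gL addrC addKr.
  by apply: iA => //; rewrite addrC addKr.
exists (\rank A) => x; exists setT, (fun i _ => row i (row_base A)).
split=> [||i|y _ X]; [exact: openT|by []|by move=> k; exact: Ck_cst|].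
have XE (i : 'I_(\rank A)) : X`_i = row i (row_base A).
  by rewrite -tnth_nth tnth_mktuple.
split.
  apply/freeP => c /eqP; rewrite (eq_bigr (fun i => c i *: row i (row_base A))); last first.
    by move=> i _; rewrite XE.
  have -> : \sum_i c i *: row i (row_base A) = (\row_i c i) *m row_base A.
    by rewrite mulmx_sum_row; apply: eq_bigr => i _; rewrite mxE.
  rewrite -(mul0mx _ (row_base A)) => /eqP/(row_free_inj (row_base_free A)) c0 i.
  by have /rowP/(_ i) := c0; rewrite !mxE.
rewrite DE; apply/seteqP; split=> v /=.
  rewrite -(eq_row_base A) => /submxP[c ->]; rewrite mulmx_sum_row.
  apply: memv_suml => i _; rewrite memvZ// -XE memv_span// mem_nth// size_tuple.
  exact: ltn_ord.
move=> /coord_span ->; apply: summx_sub => i _; apply: scalemx_sub.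
rewrite -(eq_row_base A).
have /mapP[j _ ->] : X`_i \in tval X by apply: mem_nth; rewrite size_tuple (leq_trans (ltn_ord i))// card_ord.
exact: row_sub.
Qed.

End Parallel.

Section Families.
Variables (R : realType) (n : nat) (Pi : set ('rV[R]_n -> 'rV[R]_n)).
Hypothesis hB : bieberbach Pi.
Variables (I : Type) (D : I -> 'rV[R]_n -> set 'rV[R]_n) (F : I -> 'M[R]_n).
Hypothesis cF : forall i, compact_dir Pi (F i).
Hypothesis DF : forall i y, D i y = [set v | (v <= F i)%MS].

(** A is of maximal rank among the compact directions contained in the span; then
    A + F i is not larger. *)
Lemma span_compact_dir : exists2 A, compact_dir Pi A &
  forall y, span_distribution D y = [set v | (v <= A)%MS].
Proof.
pose S (v : 'rV[R]_n) := exists2 X : seq 'rV[R]_n,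
  (forall w, w \in X -> exists i, (w <= F i)%MS) & v \in <<X>>%VS.
have SD u v : S u -> S v -> S (u + v).
  move=> [X XF uX] [Y YF vY]; exists (X ++ Y); last by rewrite span_cat memv_add.
  by move=> w; rewrite mem_cat => /orP[/XF|/YF].
have [|A [cA AS] Amax] := @max_rank_mx R n
    (fun A => compact_dir Pi A /\ forall v : 'rV_n, (v <= A)%MS -> S v) 0.
  split=> [|v]; first exact: compact_dir0.
  by rewrite submx0 => /eqP ->; exists [::]; rewrite ?mem0v.
have FA i : (F i <= A)%MS.
  apply: submx_trans (addsmxSr A (F i)) _; apply: Amax; last exact: addsmxSl.
  split=> [|v /sub_addsmxP[[a b] /= ->]]; first exact: compact_dirD.
  apply: SD; first by apply: AS; exact: submxMl.
  exists [:: b *m F i]; last by rewrite memv_span1.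
  by move=> w; rewrite inE => /eqP ->; exists i; exact: submxMl.
exists A => // y; apply/seteqP; split=> v /=.
  move=> [X XD] /(coord_span (X := in_tuple X)) ->.
  apply: summx_sub => i _; apply: scalemx_sub.
  have [j] := XD _ (mem_nth 0 (ltn_ord i)); rewrite DF => /= h.
  exact: submx_trans h (FA j).
move=> /AS[X XF vX]; exists X => // w /XF[i wF]; exists i.
by rewrite DF.
Qed.

(** A is of minimal rank among the compact directions containing the
    intersection; then the intersection of A and F i is not smaller. *)
Lemma cap_compact_dir : exists2 A, compact_dir Pi A &
  forall y, cap_distribution D y = [set v | (v <= A)%MS].
Proof.
have [|A [cA AC] Amin] := @min_rank_mx R n (fun A => compact_dir Pi A /\
    forall v : 'rV_n, (forall i, (v <= F i)%MS) -> (v <= A)%MS) 1%:M.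
  by split=> [|v _]; [exact: compact_dir1|exact: submx1].
have AF i : (A <= F i)%MS.
  apply: submx_trans (capmxSr A (F i)); apply: Amin; last exact: capmxSl.
  split=> [|v vF]; first exact: compact_dirI.
  by rewrite sub_capmx AC//= vF.
exists A => // y; apply/seteqP; split=> v /=.
  by move=> vD; apply: AC => i; have := vD i Logic.I; rewrite DF.
by move=> vA i _; rewrite DF; exact: submx_trans (AF i).
Qed.

End Families.

Theorem corollary2 (R : realType) (n : nat)
    (Pi : set ('rV[R]_n -> 'rV[R]_n)) (hPi : bieberbach Pi)
    (I : Type) (D : I -> 'rV[R]_n -> set 'rV[R]_n)
    (hD : forall i, parallel_distribution_with_compact_leaves Pi (D i)) :
  parallel_distribution_with_compact_leaves Pi (span_distribution D) /\
  parallel_distribution_with_compact_leaves Pi (cap_distribution D).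
Proof.
have /choice[F FP] : forall i, exists A : 'M[R]_n,
    compact_dir Pi A /\ forall y, D i y = [set v | (v <= A)%MS].
  by move=> i; have [A ? ?] := parallel_compact_dir hPi (hD i); exists A.
have cF i := proj1 (FP i); have DF i := proj2 (FP i).
have [A cA AE] := span_compact_dir hPi cF DF.
have [A' cA' AE'] := cap_compact_dir hPi cF DF.
by split; [exact: compact_dir_parallel AE|exact: compact_dir_parallel AE'].
Qed.
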